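(* Let $X$ and $Z$ be disjoint finite sets, $Q$ a partial order relation on $Z$, $y$ a point not in $X \cup Z$, $A_y = \{(y,y)\}$, and $W = X \cup Z$. Then for every $R \in \mathfrak{M}^*_{Q + A_y}(X, Z \cup \{y\})$, the relation $R|_W$ lies in $\mathfrak{U}(W \cap \downarrow_R y,\ W \setminus \downarrow_R y)$, and the mapping $$\sigma : \mathfrak{M}^*_{Q + A_y}(X, Z \cup \{y\}) \to \mathfrak{C}_{Q^d}(X, Z),\qquad R \mapsto \tau_{W \cap \downarrow_R y,\ W \setminus \downarrow_R y}(R|_W)$$ is well defined and bijective.
   Context: A partial order relation (p.o.r.) on a set $S$ is a reflexive, antisymmetric, transitive subset of $S \times S$; $\mathfrak{P}(S)$ denotes the set of p.o.r.s on $S$. For $R \in \mathfrak{P}(S)$ and $M \subseteq S$: $R|_M = R \cap (M \times M)$; $R^d = \{(b,a) : (a,b) \in R\}$; $\downarrow_R M = \{x \in S : (x,m) \in R \text{ for some } m \in M\}$, $\downarrow_R x = \downarrow_R\{x\}$. $M$ is an upper end of $R$ if $(m,x) \in R$, $m \in M$ imply $x \in M$; $M$ is convex in $R$ if $(a,x),(x,b) \in R$ with $a,b \in M$ imply $x \in M$. $\max R$ is the set of maximal points of $R$ ($x$ with $(x,z)\in R \Rightarrow z=x$). For p.o.r.s on disjoint carriers, $R_1 + R_2 = R_1 \cup R_2$. For disjoint finite sets $X', Y'$ and $Q' \in \mathfrak{P}(Y')$ define: $\mathfrak{U}(X',Y') = \{R \in \mathfrak{P}(X' \cup Y') : Y'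 \text{ is an upper end of } R\}$; $\mathfrak{C}_{Q'}(X',Y') = \{R \in \mathfrak{P}(X' \cup Y') : R|_{Y'} = Q' \text{ and } Y' \text{ is convex in } R\}$; $\mathfrak{M}^*_{Q'}(X',Y') = \{R \in \mathfrak{C}_{Q'}(X',Y') : \max Q' = \max R\}$. Finally, $\tau_{X',Y'} : \mathfrak{U}(X',Y') \to \mathfrak{U}(X',Y')$ is defined by $\tau_{X',Y'}(R) = (R|_{X'})^d \cup ((X' \times Y') \setminus R) \cup (R|_{Y'})^d$. *)

(* Defs.v *)
From mathcomp Require Import all_boot.

Set Implicit Arguments.
Unset Strict Implicit.
Unset Printing Implicit Defensive.

(* Finite sets and relations live in an ambient finite type T, a relation being
   a subset of T * T.  A relation does not record its carrier S, so the notions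
   depending on the carrier take it as an argument. *)
Section PartialOrderRelations.
Variable T : finType.
Implicit Types (S M X Y : {set T}) (R Q : {set T * T}).

Definition is_por S R : bool :=
  [&& R \subset setX S S,
      [forall x in S, (x, x) \in R],
      [forall a, forall b, ((a, b) \in R) && ((b, a) \in R) ==> (a == b)]
    & [forall a, forall b, forall c,
         ((a, b) \in R) && ((b, c) \in R) ==> ((a, c) \in R)]].

Definition pors S : {set {set T * T}} := [set R | is_por S R].

Definition rel_restr R M : {set T * T} := R :&: setX M M.

Definition rel_dual R : {set T * T} := [set p | (p.2, p.1) \in R].

Definition down R M : {set T} := [set x | [exists m in M, (x, m) \in R]].

Definition upper_end R M : bool :=
  [forall m in M, forall x, ((m, x) \in R) ==> (x \in M)].

Definition convex_in R M : bool :=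
  [forall a in M, forall b in M, forall x,
     ((a, x) \in R) && ((x, b) \in R) ==> (x \in M)].

(* The carrier S is needed: a point of T outside S is related to nothing and
   would otherwise count as maximal. *)
Definition max_points S R : {set T} :=
  [set x in S | [forall z, ((x, z) \in R) ==> (z == x)]].

Definition frakU X Y : {set {set T * T}} :=
  [set R in pors (X :|: Y) | upper_end R Y].

Definition frakC Q X Y : {set {set T * T}} :=
  [set R in pors (X :|: Y) | (rel_restr R Y == Q) && convex_in R Y].

Definition frakMstar Q X Y : {set {set T * T}} :=
  [set R in frakC Q X Y | max_points Y Q == max_points (X :|: Y) R].

(* Defined on all relations; meant for R in frakU X Y with X, Y disjoint. *)
Definition tau X Y R : {set T * T} :=
  rel_dual (rel_restr R X) :|: (setX X Y :\: R) :|: rel_dual (rel_restr R Y).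

End PartialOrderRelations.

(* Main.v *)
Require Import Defs.
From mathcomp Require Import all_boot.

Set Implicit Arguments.
Unset Strict Implicit.
Unset Printing Implicit Defensive.

(** Write D for the points of W below y and U for the other points of W, so
    that Z is contained in U.  Every point of U lies below an R-maximal point
    other than y, hence below a point of Z; since tau reverses the order inside
    U and keeps U an upper end, U is recovered from S = sigma R as the S-up-set
    generated by Z.  As tau is an involution for fixed D and U, R is then
    recovered by applying tau to S and putting y back on top of D. *)

(** * Finite orders as sets of pairs: reflection lemmas and maximal points *)

Section Relations.
Variable T : finType.
Implicit Types (S M X Y D U : {set T}) (R : {set T * T}) (a b x y : T).

Lemma porP S R :
  reflect [/\ forall a b, (a, b) \in R -> a \in S /\ b \in S,
              forall a, a \in S -> (a, a) \in R,
              forall a b, (a, b) \in R -> (b, a) \in R -> a = b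
            & forall b a c, (a, b) \in R -> (b, c) \in R -> (a, c) \in R]
          (R \in pors S).
Proof.
rewrite inE; apply: (iffP and4P) => -[sub refl anti trans]; split.
- by move=> a b /(subsetP sub); rewrite !inE => /andP[].
- exact: forall_inP refl.
- move=> a b Rab Rba; apply/eqP.
  by move/forallP/(_ a)/forallP/(_ b)/implyP: anti; apply; rewrite Rab.
- move=> b a c Rab Rbc.
  move/forallP/(_ a)/forallP/(_ b)/forallP/(_ c)/implyP: trans.
  by apply; rewrite Rab.
- by apply/subsetP => -[a b] /sub[aS bS]; rewrite !inE aS.
- exact/forall_inP.
- apply/forallP=> a; apply/forallP=> b; apply/implyP=> /andP[Rab Rba].
  exact/eqP/anti.
- apply/forallP=> a; apply/forallP=> b; apply/forallP=> c.
  apply/implyP=> /andP[]; exact: trans.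
Qed.

Lemma upper_endP R M :
  reflect (forall m x, m \in M -> (m, x) \in R -> x \in M) (upper_end R M).
Proof.
apply: (iffP forall_inP) => [h m x mM|h m mM].
  exact/implyP/(forallP (h m mM)).
by apply/forallP=> x; apply/implyP; apply: h.
Qed.

Lemma convexP R M :
  reflect (forall a b x, a \in M -> b \in M -> (a, x) \in R -> (x, b) \in R ->
             x \in M) (convex_in R M).
Proof.
apply: (iffP forall_inP) => [h a b x aM bM Rax Rxb|h a aM].
  move/forall_inP/(_ b bM)/forallP/(_ x)/implyP: (h a aM).
  by apply; rewrite Rax.
apply/forall_inP=> b bM; apply/forallP=> x; apply/implyP=> /andP[].
exact: h.
Qed.

Lemma in_restr R M a b :
  ((a, b) \in rel_restr R M) = [&& (a, b) \in R, a \in M & b \in M].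
Proof. by rewrite !inE. Qed.

Lemma in_dual R a b : ((a, b) \in rel_dual R) = ((b, a) \in R).
Proof. by rewrite inE. Qed.

Lemma in_down1 R x y : (x \in down R [set y]) = ((x, y) \in R).
Proof.
rewrite inE; apply/exists_inP/idP => [[m]|Rxy]; first by rewrite inE => /eqP->.
by exists y => //; rewrite inE.
Qed.

Lemma max_pointsP S R x :
  reflect (x \in S /\ forall z, (x, z) \in R -> z = x) (x \in max_points S R).
Proof.
rewrite inE; apply: (iffP andP) => -[xS h]; split=> //.
  by move=> z Rxz; apply/eqP; move/forallP/(_ z)/implyP: h; apply.
by apply/forallP=> z; apply/implyP=> /h->.
Qed.

Lemma restr_por S R M : R \in pors S -> M \subset S -> rel_restr R M \in pors M.
Proof.
case/porP=> _ refl anti trans /subsetP MS; apply/porP; split.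
- by move=> a b; rewrite in_restr => /and3P[].
- by move=> a aM; rewrite in_restr aM refl ?MS.
- by move=> a b; rewrite !in_restr => /and3P[+ _ _] /and3P[+ _ _]; apply: anti.
- move=> b a c; rewrite !in_restr => /and3P[Rab -> _] /and3P[Rbc _ ->].
  by rewrite (trans b).
Qed.

(** Induction on the size of the up-set of [x]. If [x] is not maximal, some [z] other than [x] lies
    above it; the up-set of [z] is contained in that of [x] and, by antisymmetry, omits [x]. *)
Lemma exists_max_above S R x : R \in pors S -> x \in S ->
  exists2 m, m \in max_points S R & (x, m) \in R.
Proof.
move=> porR; have [sub refl anti trans] := porP _ _ porR.
pose above a := [set z | (a, z) \in R].
have [n] := ubnP #|above x|; elim: n x => // n IH x; rewrite ltnS => le_n xS.
have [xmax|] := boolP (x \in max_points S R); first by exists x; rewrite ?refl.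
rewrite inE xS negb_forall => /existsP[z]; rewrite negb_imply => /andP[Rxz zx].
have [||m mmax Rzm] := IH z; last by exists m => //; apply: trans Rxz Rzm.
  apply: leq_trans le_n; apply: proper_card; apply/properP; split.
    by apply/subsetP=> w; rewrite !inE; apply: trans.
  exists x; rewrite !inE ?refl //.
  by apply: contra zx => Rzx; rewrite (anti _ _ Rzx Rxz).
by have [] := sub _ _ Rxz.
Qed.

Lemma in_tau D U R a b : ((a, b) \in tau D U R) =
  [|| [&& (b, a) \in R, a \in D & b \in D],
      [&& (a, b) \notin R, a \in D & b \in U]
    | [&& (b, a) \in R, a \in U & b \in U]].
Proof.
rewrite !inE /= -orbA.
by rewrite [(b \in D) && (a \in D)]andbC [(b \in U) && (a \in U)]andbC.
Qed.

(** * The involution [tau] for a fixed disjoint pair [D], [U] *)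

Section Tau.
Variables (D U : {set T}).
Hypothesis disjDU : [disjoint D & U].

Lemma tau_DD R a b : a \in D -> b \in D ->
  ((a, b) \in tau D U R) = ((b, a) \in R).
Proof.
move=> aD bD; rewrite in_tau aD bD (disjointFr disjDU aD) (disjointFr disjDU bD).
by rewrite !andbF ?andbT ?orbF.
Qed.

Lemma tau_DU R a b : a \in D -> b \in U ->
  ((a, b) \in tau D U R) = ((a, b) \notin R).
Proof.
move=> aD bU; rewrite in_tau aD bU (disjointFr disjDU aD) (disjointFl disjDU bU).
by rewrite !andbF ?andbT ?orbF.
Qed.

Lemma tau_UU R a b : a \in U -> b \in U ->
  ((a, b) \in tau D U R) = ((b, a) \in R).
Proof.
move=> aU bU; rewrite in_tau aU bU (disjointFl disjDU aU) (disjointFl disjDU bU).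
by rewrite !andbF ?andbT ?orbF.
Qed.

Lemma tau_UD R a b : a \in U -> b \in D ->
  ((a, b) \in tau D U R) = false.
Proof.
move=> aU bD; rewrite in_tau aU bD (disjointFl disjDU aU) (disjointFr disjDU bD).
by rewrite !andbF ?andbT ?orbF.
Qed.

Lemma tau_sub R a b : (a, b) \in tau D U R -> a \in D :|: U /\ b \in D :|: U.
Proof.
by rewrite in_tau !inE => /or3P[] /and3P[_ -> ->]; rewrite ?orbT.
Qed.

Variable R : {set T * T}.
Hypothesis RU : R \in frakU D U.

Lemma frakU_cross a b : a \in U -> b \in D -> (a, b) \notin R.
Proof.
move: RU; rewrite inE => /andP[_ /upper_endP upU] aU bD.
by apply/negP=> /(upU _ _ aU) bU; rewrite (disjointFr disjDU bD) in bU.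
Qed.

Lemma tau_frakU : tau D U R \in frakU D U.
Proof.
have /andP[/porP[sub refl anti trans] /upper_endP upU] :
  (R \in pors (D :|: U)) && upper_end R U by move: RU; rewrite inE.
rewrite inE; apply/andP; split; last first.
  apply/upper_endP=> a b aU t; have [_] := tau_sub t.
  by rewrite inE => /orP[] // bD; rewrite tau_UD in t.
apply/porP; split.
- exact: tau_sub.
- move=> a aDU; have /orP[aP|aP] : (a \in D) || (a \in U) by rewrite -in_setU.
    by rewrite tau_DD ?refl.
  by rewrite tau_UU ?refl.
- move=> a b tab; have [/setUP[]aP /setUP[]bP] := tau_sub tab; move: tab.
  + by rewrite !tau_DD // => Rba Rab; apply: anti.
  + by rewrite [(b, a) \in _]tau_UD.
  + by rewrite tau_UD.
  + by rewrite !tau_UU // => Rba Rab; apply: anti.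
(* Of the eight placements of [a], [b], [c], the four with a step from [U] to [D] are void. The
   patterns D, D, U and D, U, U are contrapositives of transitivity of [R], because [tau]
   complements the cross pairs. *)
- move=> b a c tab tbc; have [/setUP[]aP _] := tau_sub tab;
    have [/setUP[]bP /setUP[]cP] := tau_sub tbc; move: tab tbc.
  + by rewrite !tau_DD // => Rba Rcb; apply: trans Rcb Rba.
  + by rewrite tau_DD // !tau_DU // => Rba; apply: contra; apply: trans.
  + by rewrite [(b, c) \in _]tau_UD.
  + rewrite [(b, c) \in _]tau_UU // !tau_DU // => nRab Rcb; apply: contra nRab => Rac.
    exact: trans Rac Rcb.
  + by rewrite tau_UD.
  + by rewrite tau_UD.
  + by rewrite [(b, c) \in _]tau_UD.
  + by rewrite !tau_UU // => Rba Rcb; apply: trans Rcb Rba.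
Qed.

(** Inside [D] and inside [U] the order is dualised twice, and the pairs of [D] times [U] are
    complemented twice. No pair from [U] to [D] occurs on either side, as [U] is an upper end of
    [R]. *)
Lemma tauK : tau D U (tau D U R) = R.
Proof.
have /andP[/porP[sub _ _ _] _] :
  (R \in pors (D :|: U)) && upper_end R U by move: RU; rewrite inE.
apply/setP=> -[a b]; have [|] := boolP ((a \in D :|: U) && (b \in D :|: U)).
  case/andP=> /setUP[]aP /setUP[]bP.
  - by rewrite !tau_DD.
  - by rewrite !tau_DU // negbK.
  - by rewrite tau_UD // (negPf (frakU_cross aP bP)).
  - by rewrite !tau_UU.
by move=> out; apply/idP/idP=> [/tau_sub|/sub] [aW bW]; rewrite aW bW in out.
Qed.

End Tau.

(** * Ingredients of the inverse map: generated up-sets and a new top point *)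

Definition up R M : {set T} := [set x | [exists m in M, (m, x) \in R]].

Lemma upP R M x : reflect (exists2 m, m \in M & (m, x) \in R) (x \in up R M).
Proof. by rewrite inE; apply: exists_inP. Qed.

(** Meant for [R] not involving [y]: the new point is then maximal with [D] as its strict lower set.
    Joining [y] to [D] in the first factor supplies reflexivity at [y]. *)
Definition add_top D y R : {set T * T} := R :|: setX (D :|: [set y]) [set y].

Lemma in_add_top D y R a b :
  ((a, b) \in add_top D y R) = ((a, b) \in R) || ((a \in y |: D) && (b == y)).
Proof. by rewrite !inE /= orbC [(a == y) || _]orbC orbC. Qed.

End Relations.

(** * The map [sigma] and its candidate inverse *)

Section Sigma.
Variables (T : finType) (X Z : {set T}) (Q : {set T * T}) (y : T).
Hypothesis porQ : Q \in pors Z.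
Hypothesis yNXZ : y \notin X :|: Z.

Let W := X :|: Z.
Let dom := frakMstar (Q :|: [set (y, y)]) X (Z :|: [set y]).
Let cod := frakC (rel_dual Q) X Z.

Definition sigma (R : {set T * T}) :=
  tau (W :&: down R [set y]) (W :\: down R [set y]) (rel_restr R W).

Definition sigma_inv (S : {set T * T}) :=
  add_top (W :\: up S Z) y (tau (W :\: up S Z) (up S Z) S).

Lemma Z_subW : Z \subset W. Proof. exact: subsetUr. Qed.

Lemma neq_y x : x \in W -> x != y.
Proof. by apply: contraTneq => ->. Qed.

Lemma yNZ : y \notin Z.
Proof. by apply: contra yNXZ; apply: (subsetP Z_subW). Qed.

(** The two summands do not interact. Hence the maximality condition in [dom] forces every maximal
    point other than [y] to lie in [Z]. *)
Lemma max_sum x :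
  (x \in max_points (Z :|: [set y]) (Q :|: [set (y, y)])) =
  (x == y) || (x \in max_points Z Q).
Proof.
have [Qsub _ _ _] := porP _ _ porQ.
apply/max_pointsP/idP => [[]|/orP[/eqP->|/max_pointsP[xZ xmax]]].
- rewrite in_setU in_set1 orbC => /orP[->//|xZ] xmax; apply/orP; right.
  by apply/max_pointsP; split=> // z Qxz; apply: xmax; rewrite inE Qxz.
- split=> [|z]; first by rewrite !inE eqxx orbT.
  rewrite !inE xpair_eqE eqxx => /orP[/Qsub[yZ]|/eqP//].
  by have := yNZ; rewrite yZ.
split=> [|z]; first by rewrite inE xZ.
rewrite !inE xpair_eqE [x == y](negPf (neq_y _)) ?orbF; first exact: xmax.
exact: subsetP Z_subW _ xZ.
Qed.

(** * From [dom] to [cod], and left inversion *)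

Section Direct.
Variable R : {set T * T}.
Hypothesis Rdom : R \in dom.
Let D := W :&: down R [set y].
Let U := W :\: down R [set y].

Lemma domP :
  [/\ R \in pors (W :|: [set y]), rel_restr R (Z :|: [set y]) = Q :|: [set (y, y)],
      convex_in R (Z :|: [set y])
    & max_points (Z :|: [set y]) (Q :|: [set (y, y)]) = max_points (W :|: [set y]) R].
Proof.
move: Rdom; rewrite inE => /andP[]; rewrite inE setUA.
by move=> /andP[? /andP[/eqP ? ?]] /eqP.
Qed.

Lemma DU_disjoint : [disjoint D & U].
Proof.
rewrite -setI_eq0; apply/eqP/setP=> x; rewrite in_setI in_setI in_setD in_set0.
by case: (x \in down R _); rewrite ?andbF.
Qed.

Lemma DUW : D :|: U = W. Proof. exact: setID. Qed.

Lemma in_D x : (x \in D) = (x \in W) && ((x, y) \in R).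
Proof. by rewrite inE in_down1. Qed.

Lemma in_U x : (x \in U) = (x \in W) && ((x, y) \notin R).
Proof. by rewrite inE in_down1 andbC. Qed.

Lemma dom_Q a b : a \in Z -> b \in Z -> ((a, b) \in R) = ((a, b) \in Q).
Proof.
move=> aZ bZ; have [_ /setP/(_ (a, b)) + _ _] := domP.
rewrite in_restr !inE aZ bZ andbT => ->.
rewrite xpair_eqE [a == y](negPf (neq_y _)) ?orbF //.
exact: subsetP Z_subW _ aZ.
Qed.

(** On [Z] together with [y] the order is a disjoint sum, so it has no cross pair. This is what
    places [Z] inside [U]. *)
Lemma dom_Zy z : z \in Z -> (z, y) \notin R.
Proof.
move=> zZ; have [_ /setP/(_ (z, y)) + _ _] := domP.
rewrite in_restr !inE zZ eqxx orbT !andbT => ->.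
rewrite xpair_eqE [z == y](negPf (neq_y _)) ?orbF; last exact: subsetP Z_subW _ zZ.
apply/negP=> Qzy; have [sub _ _ _] := porP _ _ porQ.
by have [_ /(subsetP Z_subW)/neq_y] := sub _ _ Qzy; rewrite eqxx.
Qed.

Lemma Z_subU : Z \subset U.
Proof. by apply/subsetP=> z zZ; rewrite in_U dom_Zy // (subsetP Z_subW). Qed.

Lemma max_dom x : (x \in max_points (W :|: [set y]) R) =
  (x == y) || (x \in max_points Z Q).
Proof. by have [_ _ _ <-] := domP; apply: max_sum. Qed.

Lemma dom_y_max x : (y, x) \in R -> x = y.
Proof.
have /max_pointsP[_ ymax] : y \in max_points (W :|: [set y]) R.
  by rewrite max_dom eqxx.
exact: ymax.
Qed.

(** By transitivity, a point above one that is not below [y] is itself not below [y]. *)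
Lemma restr_frakU : rel_restr R W \in frakU D U.
Proof.
have [porR _ _ _] := domP; have [_ _ _ trans] := porP _ _ porR.
rewrite inE DUW (restr_por porR) ?subsetUl //=.
apply/upper_endP=> a b; rewrite !in_U in_restr => /andP[_ nRay] /and3P[Rab _ ->].
by apply: contra nRay; apply: trans.
Qed.

Lemma sigma_frakU : sigma R \in frakU D U.
Proof. exact: (tau_frakU DU_disjoint restr_frakU). Qed.

Lemma sigma_U a b : a \in U -> b \in U -> ((a, b) \in sigma R) = ((b, a) \in R).
Proof.
move=> aU bU; rewrite (tau_UU DU_disjoint) // in_restr.
by move: aU bU; rewrite !in_U => /andP[-> _] /andP[-> _]; rewrite !andbT.
Qed.

(** On [U], which contains [Z], the map merely dualises, so [Q] becomes its dual. For convexity, a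
    point between two points of [Z] stays in the upper end [U]; there the interval is a reversed
    [R]-interval, so the point lies in [Z] or is [y], and [y] is not in [W]. *)
Lemma sigma_cod : sigma R \in cod.
Proof.
have [porR _ /convexP conv _] := domP.
have /andP[porS /upper_endP upU] :
  (sigma R \in pors (D :|: U)) && upper_end (sigma R) U.
  by have := sigma_frakU; rewrite inE.
have ZsubU := subsetP Z_subU; have [Qsub _ _ _] := porP _ _ porQ.
rewrite DUW in porS; rewrite inE porS /=; apply/andP; split.
  apply/eqP/setP=> -[a b]; rewrite in_restr in_dual.
  have [/andP[aZ bZ]|] := boolP ((a \in Z) && (b \in Z)).
    by rewrite andbT sigma_U ?ZsubU // dom_Q.
  move=> out; rewrite andbF; apply/esym/negP=> /Qsub[bZ aZ].
  by rewrite aZ bZ in out.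
apply/convexP=> a b x aZ bZ Sax Sxb.
have xU : x \in U by apply: upU Sax; apply: ZsubU.
rewrite !sigma_U ?(ZsubU _ aZ) ?(ZsubU _ bZ) // in Sax Sxb.
have /setUP[//|/set1P xy] : x \in Z :|: [set y].
  by apply: conv Sxb Sax; rewrite in_setU ?aZ ?bZ.
by move: xU; rewrite xy in_U (negPf yNXZ).
Qed.

(** For the inclusion from right to left, take an [R]-maximal point above [x] in [U]. It is not [y],
    so it belongs to [Z], and dualising puts it below [x]. This makes [U] recoverable from [sigma R]
    alone. *)
Lemma up_sigma : up (sigma R) Z = U.
Proof.
have [porR _ _ _] := domP.
have := sigma_frakU; rewrite inE => /andP[_ /upper_endP upU].
have ZsubU := subsetP Z_subU.
apply/setP=> x; apply/upP/idP => [[z zZ]|xU]; first exact/upU/ZsubU.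
have /andP[xW nRxy] : (x \in W) && ((x, y) \notin R) by rewrite -in_U.
have [|m] := exists_max_above (x := x) porR; first by rewrite inE xW.
rewrite max_dom => /orP[/eqP->|/max_pointsP[mZ _] Rxm].
  by rewrite (negPf nRxy).
by exists m; rewrite ?sigma_U ?(ZsubU _ mZ).
Qed.

Lemma sigmaK : sigma_inv (sigma R) = R.
Proof.
have [porR _ _ _] := domP; have [sub refl _ _] := porP _ _ porR.
rewrite /sigma_inv up_sigma -DUW.
have -> : (D :|: U) :\: U = D.
  by rewrite setDUl setDv setU0; apply/setDidPl/DU_disjoint.
rewrite tauK ?DU_disjoint ?restr_frakU //.
have yNW : (y \in W) = false by apply: negPf.
(* Once [tau] has cancelled, what remains of [R] is its restriction to [W]. The missing pairs all
   end in [y], since maximality of [y] leaves only the loop among those starting there. *)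
apply/setP=> -[a b]; rewrite in_add_top in_restr in_setU1 in_D.
have [->|ay] := eqVneq a y.
  rewrite yNW andbF /=; apply/eqP/idP=> [->|]; last exact: dom_y_max.
  by apply: refl; rewrite !inE eqxx orbT.
have [->|bY] := eqVneq b y.
  rewrite yNW !andbF !andbT /=; apply/andb_idl=> /sub[].
  by rewrite !inE (negPf ay) orbF.
rewrite andbF orbF; apply/andb_idr=> /sub[].
by rewrite !in_setU !in_set1 (negPf ay) (negPf bY) !orbF => -> ->.
Qed.

End Direct.

(** * From [cod] back to [dom], and right inversion *)

Section Inverse.
Variable S : {set T * T}.
Hypothesis Scod : S \in cod.
Let U := up S Z.
Let D := W :\: U.
Let R := sigma_inv S.

Lemma codP : [/\ S \in pors W, rel_restr S Z = rel_dual Q & convex_in S Z].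
Proof. by move: Scod; rewrite inE => /andP[? /andP[/eqP ? ?]]. Qed.

Lemma up_subW : U \subset W.
Proof.
have [/porP[sub _ _ _] _ _] := codP.
by apply/subsetP=> x /upP[z _ /sub[]].
Qed.

Lemma Z_sub_up : Z \subset U.
Proof.
have [/porP[_ refl _ _] _ _] := codP; apply/subsetP=> z zZ; apply/upP.
by exists z; rewrite ?refl ?(subsetP Z_subW).
Qed.

Lemma compl_up_cover : D :|: U = W.
Proof. by rewrite setUC -{1}(setIidPr up_subW) setID. Qed.

Lemma compl_up_disjoint : [disjoint D & U].
Proof. by apply/setDidPl; rewrite setDDl setUid. Qed.

Lemma cod_frakU : S \in frakU D U.
Proof.
have [porS _ _] := codP; have [_ _ _ trans] := porP _ _ porS.
rewrite inE compl_up_cover porS; apply/upper_endP=> a b /upP[z zZ Sza] Sab.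
by apply/upP; exists z => //; apply: trans Sza Sab.
Qed.

Lemma tau_por : tau D U S \in pors W /\ upper_end (tau D U S) U.
Proof.
by have := tau_frakU compl_up_disjoint cod_frakU; rewrite inE compl_up_cover => /andP[].
Qed.

Lemma in_inv a b :
  ((a, b) \in R) = ((a, b) \in tau D U S) || ((a \in y |: D) && (b == y)).
Proof. exact: in_add_top. Qed.

Lemma inv_W a b : b \in W -> ((a, b) \in R) = ((a, b) \in tau D U S).
Proof. by move=> /neq_y/negPf bY; rewrite in_inv bY andbF orbF. Qed.

Lemma inv_y a : ((a, y) \in R) = (a \in y |: D).
Proof.
have [/porP[sub _ _ _] _] := tau_por.
by rewrite in_inv eqxx andbT; apply/orb_idl => /sub[_]; rewrite (negPf yNXZ).
Qed.

Lemma inv_yl b : (y, b) \in R -> b = y.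
Proof.
have [/porP[sub _ _ _] _] := tau_por.
by rewrite in_inv => /orP[/sub[]|/andP[_ /eqP//]]; rewrite (negPf yNXZ).
Qed.

Lemma inv_por : R \in pors (W :|: [set y]).
Proof.
have [/porP[sub refl anti trans] /upper_endP upU] := tau_por.
have DW a : a \in D -> a \in W by rewrite inE => /andP[].
(* As the complement in [W] of an upper end, [D] is closed downwards; this gives transitivity for
   chains ending in [y]. *)
have low a b : b \in D -> (a, b) \in tau D U S -> a \in D.
  move=> bD t; have [aW _] := sub _ _ t; rewrite inE aW andbT.
  by apply: contraL bD => /upU/(_ t) bU; rewrite inE bU.
apply/porP; split.
- move=> a b; rewrite in_inv => /orP[/sub[aW bW]|/andP[aP /eqP->]].
    by split; apply/setUP; left.
  split; apply/setUP; last by right; apply: set11.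
  by case/setU1P: aP => [->|/DW]; [right; apply: set11|left].
- move=> a /setUP[aW|/set1P->]; last by rewrite inv_y setU11.
  by rewrite inv_W ?refl.
- move=> a b; have [->|bY] := eqVneq b y; first by move=> _ /inv_yl.
  have [->|aY] := eqVneq a y; first by move/inv_yl.
  rewrite !in_inv (negPf aY) (negPf bY) !andbF !orbF; exact: anti.
- move=> b a c; have [->|cY] := eqVneq c y.
    rewrite !inv_y in_inv => /orP[+|/andP[->]//].
    rewrite !in_setU1 => t /orP[/eqP bY|bD]; last by rewrite (low _ _ bD) ?orbT.
    by have [_] := sub _ _ t; rewrite bY (negPf yNXZ).
  rewrite [(b, c) \in _]in_inv [(a, c) \in _]in_inv (negPf cY) !andbF !orbF.
  move=> + Rbc; have [bW _] := sub _ _ Rbc.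
  by rewrite inv_W // => Rab; apply: trans Rab Rbc.
Qed.

Lemma inv_U a b : a \in U -> b \in U -> ((a, b) \in R) = ((b, a) \in S).
Proof. by move=> aU bU; rewrite inv_W ?(subsetP up_subW) // tau_UU ?compl_up_disjoint. Qed.

Lemma inv_Q a b : a \in Z -> b \in Z -> ((a, b) \in R) = ((a, b) \in Q).
Proof.
move=> aZ bZ; have [_ /setP/(_ (b, a)) + _] := codP.
by rewrite in_restr in_dual aZ bZ !andbT inv_U // (subsetP Z_sub_up).
Qed.

Lemma inv_Uy a : a \in U -> (a, y) \notin R.
Proof.
move=> aU; rewrite inv_y; apply/negP=> /setU1P[aY|/setDP[_ /negP//]].
by have := neq_y (subsetP up_subW _ aU); rewrite aY eqxx.
Qed.

Lemma inv_restr : rel_restr R (Z :|: [set y]) = Q :|: [set (y, y)].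
Proof.
have [Qsub _ _ _] := porP _ _ porQ.
apply/setP=> -[a b]; rewrite in_restr; apply/and3P/idP.
  case=> Rab /setUP[aZ|/set1P aY] /setUP[bZ|/set1P bY].
  - by rewrite inE -inv_Q ?Rab.
  - by move: Rab; rewrite bY (negPf (inv_Uy _)) // (subsetP Z_sub_up).
  - by move: bZ Rab; rewrite aY => bZ /inv_yl bY; have := yNZ; rewrite -bY bZ.
  - by rewrite aY bY !inE eqxx orbT.
case/setUP=> [Qab|/set1P[-> ->]]; last by rewrite inv_y !inE !eqxx !orbT.
by have [aZ bZ] := Qsub _ _ Qab; rewrite inv_Q // !in_setU aZ bZ.
Qed.

(** [U] is an upper end of the [tau] part, and [y] sits above no point of [U]. So whatever lies
    above [Z] stays where [R] is simply the dual of [S]. *)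
Lemma inv_up z x : z \in Z -> (z, x) \in R -> x \in U.
Proof.
move=> /(subsetP Z_sub_up) zU Rzx.
have [sub _ _ _] := porP _ _ inv_por; have [_ /upper_endP upU] := tau_por.
have [_ /setUP[xW|/set1P xY]] := sub _ _ Rzx.
  by apply: upU zU _; rewrite -inv_W.
by move: Rzx; rewrite xY (negPf (inv_Uy zU)).
Qed.

(** Nothing but [y] lies above [y], and an interval starting in [Z] stays in [U], so it cannot end
    in [y]. Intervals between points of [Z] are reversed [S]-intervals. *)
Lemma inv_convex : convex_in R (Z :|: [set y]).
Proof.
have [_ _ /convexP convS] := codP; have Zup := subsetP Z_sub_up.
apply/convexP=> a b x /setUP[aZ|/set1P->] bP Rax Rxb; last first.
  by rewrite (inv_yl Rax) in_setU set11 orbT.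
have xU := inv_up aZ Rax; rewrite inE.
case/setUP: bP Rxb => [bZ|/set1P->] Rxb; last by rewrite (negPf (inv_Uy xU)) in Rxb.
rewrite !inv_U ?(Zup _ aZ) ?(Zup _ bZ) // in Rax Rxb.
by rewrite (convS b a x).
Qed.

Lemma inv_max x : (x \in max_points (W :|: [set y]) R) =
  (x == y) || (x \in max_points Z Q).
Proof.
have [_ _ /convexP convS] := codP; have Zup := subsetP Z_sub_up.
have [Qsub _ _ _] := porP _ _ porQ.
apply/idP/idP => [/max_pointsP[/setUP[xW|/set1P->] xmax]|]; last 2 first.
- by rewrite eqxx.
- case/orP=> [/eqP->|/max_pointsP[xZ xmax]]; apply/max_pointsP; split.
  + by rewrite in_setU set11 orbT.
  + exact: inv_yl.
  + by apply/setUP; left; apply: (subsetP Z_subW).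
  (* Membership of [z] in [U] yields a point of [Z] that is [S]-below [z], while [x] is [S]-above
     [z]. Convexity of [Z] in [S] then brings [z] into [Z], where maximality for [Q] applies. *)
  move=> z Rxz; have zU := inv_up xZ Rxz; have /upP[z' z'Z Sz'z] := zU.
  have zZ : z \in Z by apply: (convS _ _ _ z'Z xZ Sz'z); rewrite -inv_U // Zup.
  by apply: xmax; rewrite -inv_Q.
have [//|/= xY] := eqVneq x y.
(* Outside [U], the point [x] would be in [D], hence strictly below [y]. Inside [U], it is [R]-below
   some point of [Z], and maximality identifies the two. *)
have xU : x \in U.
  apply: contraNT xY => xU; rewrite eq_sym; apply/eqP/xmax.
  by rewrite inv_y; apply/setU1P; right; rewrite in_setD xU.
have /upP[z zZ Szx] := xU.
have zx : z = x by apply: xmax; rewrite inv_U // Zup.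
rewrite zx in zZ; apply/max_pointsP; split=> // w Qxw.
by apply: xmax; have [_ wZ] := Qsub _ _ Qxw; rewrite inv_Q.
Qed.

Lemma inv_dom : R \in dom.
Proof.
rewrite inE [_ \in frakC _ _ _]inE setUA inv_por inv_restr inv_convex eqxx /=.
by apply/eqP/setP=> x; rewrite max_sum inv_max.
Qed.

(** This ensures that [sigma] splits [W] into the same pair that was used to build [R], so that the
    two uses of [tau] cancel. *)
Lemma inv_down : W :&: down R [set y] = D.
Proof.
apply/setP=> x; rewrite in_setI in_down1 inv_y in_setU1.
have [xW|xW] := boolP (x \in W); first by rewrite (negPf (neq_y xW)).
by rewrite inE (negPf xW) andbF.
Qed.

Lemma sigma_invK : sigma R = S.
Proof.
have WD : W :\: down R [set y] = U.
  (* The left side is first rewritten as the complement in [W] of [W :&: down R [set y]], so that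
     [inv_down] applies. *)
  rewrite -[LHS]set0U -(setDv W) -setDIr inv_down setDDr setDv set0U.
  exact/setIidPr/up_subW.
have restrR : rel_restr R W = tau D U S.
  have [/porP[sub _ _ _] _] := tau_por.
  apply/setP=> -[a b]; rewrite in_restr.
  have [bW|bW] := boolP (b \in W); last first.
    by rewrite !andbF; apply/esym/negP=> /sub[_]; apply/negP.
  by rewrite andbT inv_W //; apply/andb_idr=> /sub[].
by rewrite /sigma WD restrR inv_down tauK ?compl_up_disjoint ?cod_frakU.
Qed.

End Inverse.
End Sigma.

Theorem theorem3 (T : finType) (X Z : {set T}) (Q : {set T * T}) (y : T)
    (disjXZ : [disjoint X & Z]) (porQ : Q \in pors Z)
    (yNXZ : y \notin X :|: Z) :
  let W := X :|: Z in
  let A_y := [set (y, y)] in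
  let dom := frakMstar (Q :|: A_y) X (Z :|: [set y]) in
  let cod := frakC (rel_dual Q) X Z in
  (forall R : {set T * T}, R \in dom ->
     rel_restr R W \in frakU (W :&: down R [set y]) (W :\: down R [set y])) /\
  (exists sigma : {R : {set T * T} | R \in dom} -> {S : {set T * T} | S \in cod},
     (forall R : {R : {set T * T} | R \in dom},
        val (sigma R) =
        tau (W :&: down (val R) [set y]) (W :\: down (val R) [set y])
            (rel_restr (val R) W)) /\
     bijective sigma).
Proof.
move=> W A_y dom cod; split=> [R Rdom|]; first exact: restr_frakU Rdom.
(* Well-definedness is carried by the membership proofs given to [Sub]; equality in the subtypes
   reduces to equality of relations. *)
pose f (R : {R | R \in dom}) : {S | S \in cod} :=
  Sub (sigma X Z y (val R)) (sigma_cod porQ yNXZ (valP R)).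
pose g (S : {S | S \in cod}) : {R | R \in dom} :=
  Sub (sigma_inv X Z y (val S)) (inv_dom porQ yNXZ (valP S)).
exists f; split=> [//|]; exists g => [R|S]; apply: val_inj => /=.
  exact: (sigmaK porQ yNXZ (valP R)).
exact: (sigma_invK yNXZ (valP S)).
Qed.
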